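(* Let $\{\Omega_i\}_{i\in\mathbb{N}}$ be a countable system of closed sets in $\mathbb{R}^n$ and let $\bar x\in\bigcap_{i=1}^\infty\Omega_i$ be a contingent local extremal point of this system. Assume that the contingent cones $T(\bar x;\Omega_i)$ are nonoverlapping: $$\bigcap_{i=1}^\infty T(\bar x;\Omega_i)=\{0\}.$$ Then there are normal vectors $$x_i^*\in N(0;\Lambda_i)\subset N(\bar x;\Omega_i)\quad\text{for }\ \Lambda_i:=T(\bar x;\Omega_i),\quad i\in\mathbb{N},$$ satisfying $$\sum_{i=1}^{\infty}\frac{1}{2^i}x_i^*=0\quad\text{and}\quad\sum_{i=1}^{\infty}\frac{1}{2^i}\|x_i^*\|^2=1.$$
   Context: $\mathbb{R}^n$ carries the Euclidean norm $\|\cdot\|$ and is identified with its dual; $\mathbb{N}=\{1,2,\ldots\}$. Contingent cone: $T(\bar x;\Omega)=\{v\mid \exists\, t_k\downarrow 0,\ v_k\to v \text{ with } \bar x+t_kv_k\in\Omega\ \forall k\in\mathbb{N}\}$ (here $t_k>0$, $t_k\to0$). $\bar x\in\bigcap_i\Omega_i$ is a contingent local extremal point of $\{\Omega_i\}_{i\in\mathbb{N}}$ if the system of cones $\Lambda_i=T(\bar x;\Omega_i)$ is extremal at the origin, i.e. there is a bounded sequence $\{a_i\}_{i\in\mathbb{N}}\subset\mathbb{R}^n$ with $\bigcap_{i=1}^\infty(\Lambda_i-a_i)=\emptyset$. For $\Omega\subset\mathbb{R}^n$, $\bar x\in\Omega$, $\varepsilon\ge 0$, the set of $\varepsilon$-normals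 is $$\widehat N_\varepsilon(\bar x;\Omega)=\Big\{x^*\Big|\ \limsup_{x\to\bar x,\,x\in\Omega,\,x\neq\bar x}\frac{\langle x^*,x-\bar x\rangle}{\|x-\bar x\|}\le\varepsilon\Big\}$$ (vacuous condition if $\bar x$ is isolated in $\Omega$). The limiting normal cone $N(\bar x;\Omega)$ is the set of all $x^*$ for which there are sequences $\varepsilon_k\downarrow 0$, $x_k\to\bar x$ with $x_k\in\Omega$, and $x_k^*\to x^*$ with $x_k^*\in\widehat N_{\varepsilon_k}(x_k;\Omega)$ for all $k$. *)

(* Defs.v *)
From HB Require Import structures.
From mathcomp Require Import all_boot all_order all_algebra.
From mathcomp Require Import all_classical all_reals all_analysis.
Set Implicit Arguments.
Unset Strict Implicit.
Unset Printing Implicit Defensive.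
Import Order.TTheory GRing.Theory Num.Theory.
Import numFieldNormedType.Exports.

Local Open Scope classical_set_scope.
Local Open Scope ring_scope.

(* R^n is 'rV[R]_n. The library norm `|x| on 'rV[R]_n is the max norm, so the
   Euclidean norm is defined separately; both induce the topology used for
   closedness and convergence. *)
Definition dotp (R : realType) (n : nat) (x y : 'rV[R]_n) : R :=
  \sum_(j < n) x 0 j * y 0 j.

Definition enorm (R : realType) (n : nat) (x : 'rV[R]_n) : R :=
  Num.sqrt (dotp x x).

Definition contingent_cone (R : realType) (n : nat)
    (xb : 'rV[R]_n) (Om : set 'rV[R]_n) : set 'rV[R]_n :=
  [set v | exists (t : nat -> R) (w : nat -> 'rV[R]_n),
     [/\ forall k, 0 < t k,
         t k @[k --> \oo] --> (0 : R),
         w k @[k --> \oo] --> v &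
         forall k, Om (xb + t k *: w k)]].

Definition extremal_at_origin (R : realType) (n : nat)
    (Lam : nat -> set 'rV[R]_n) : Prop :=
  exists a : nat -> 'rV[R]_n,
    (exists M : R, forall i, enorm (a i) <= M) /\
    \bigcap_i [set x - a i | x in Lam i] = set0.

Definition contingent_extremal (R : realType) (n : nat)
    (xb : 'rV[R]_n) (Om : nat -> set 'rV[R]_n) : Prop :=
  (\bigcap_i Om i) xb /\
  extremal_at_origin (fun i => contingent_cone xb (Om i)).

(* xb^' is the filter of punctured neighborhoods of xb. If xb is isolated in Om,
   then set0 belongs to within Om xb^' and the upper limit is -oo, so the
   condition is vacuous. *)
Definition eps_normals (R : realType) (n : nat) (eps : R)
    (xb : 'rV[R]_n) (Om : set 'rV[R]_n) : set 'rV[R]_n :=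
  [set xs : 'rV[R]_n |
     (limf_esup (fun x : 'rV[R]_n => (dotp xs (x - xb) / enorm (x - xb))%:E)
                (within Om xb^') <= eps%:E)%E].

Definition limiting_normal_cone (R : realType) (n : nat)
    (xb : 'rV[R]_n) (Om : set 'rV[R]_n) : set 'rV[R]_n :=
  [set xs | exists (eps : nat -> R) (x xsk : nat -> 'rV[R]_n),
     [/\ (forall k, 0 < eps k) /\ eps k @[k --> \oo] --> (0 : R),
         x k @[k --> \oo] --> xb,
         forall k, Om (x k),
         xsk k @[k --> \oo] --> xs &
         forall k, eps_normals (eps k) (x k) Om (xsk k)]].

(* Main.v *)
Require Import Defs.
From HB Require Import structures.
From mathcomp Require Import all_boot all_order all_algebra.
From mathcomp Require Import all_classical all_reals all_analysis.
From mathcomp Require Import ring lra.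
Set Implicit Arguments.
Unset Strict Implicit.
Unset Printing Implicit Defensive.
Import Order.TTheory GRing.Theory Num.Theory.
Import numFieldNormedType.Exports.

Local Open Scope classical_set_scope.
Local Open Scope ring_scope.

(** Choose a bounded [a] with no common point of the translates [Lam i - a i] of
    the contingent cones, and minimise the squared weighted distance
    [D x = \sum_i 2^-(i+1) d(x + a i; Lam i)^2]. A sequence along which [D] stays
    bounded while [|x|] grows to infinity has, after normalisation, a cluster
    point of norm one in every [Lam i], which the nonoverlapping condition
    excludes; so a minimiser [x] exists, and [D x > 0]. With [w i] a projection of
    [x + a i] on [Lam i], the quadratic [y |-> \sum_i 2^-(i+1) |y + a i - w i|^2]
    dominates [D] and agrees with it at [x], so its gradient vanishes there: the
    vectors [x + a i - w i], divided by [sqrt (D x)], are the required normals.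
    They are proximal normals at [w i], hence limiting normals at 0, because
    [w i] can be scaled down along the cone. *)

(** * Euclidean norm, its topology, and existence of minimisers *)

Section EuclideanSpace.
Context {R : realType} {n : nat}.
Implicit Types (x y z : 'rV[R]_n) (c : R).

Lemma dotpC x y : dotp x y = dotp y x.
Proof. by apply: eq_bigr => j _; rewrite mulrC. Qed.

Lemma dotpDl x y z : dotp (x + y) z = dotp x z + dotp y z.
Proof. by rewrite -big_split; apply: eq_bigr => j _; rewrite mxE mulrDl. Qed.

Lemma dotpZl c x y : dotp (c *: x) y = c * dotp x y.
Proof. by rewrite mulr_sumr; apply: eq_bigr => j _; rewrite mxE mulrA. Qed.

Lemma dotpDr x y z : dotp x (y + z) = dotp x y + dotp x z.
Proof. by rewrite dotpC dotpDl !(dotpC _ x). Qed.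

Lemma dotpZr c x y : dotp x (c *: y) = c * dotp x y.
Proof. by rewrite dotpC dotpZl dotpC. Qed.

Lemma dotpNl x y : dotp (- x) y = - dotp x y.
Proof. by rewrite -scaleN1r dotpZl mulN1r. Qed.

Lemma dotpNr x y : dotp x (- y) = - dotp x y.
Proof. by rewrite dotpC dotpNl dotpC. Qed.

Lemma dotp0 x : dotp x 0 = 0.
Proof. by rewrite /dotp big1 // => j _; rewrite mxE mulr0. Qed.

Lemma dotp_delta x j : dotp (delta_mx 0 j) x = x 0 j.
Proof.
rewrite /dotp (bigD1 j)//= big1 ?addr0 => [|i /negPf ij].
  by rewrite !mxE !eqxx mul1r.
by rewrite mxE ij mul0r.
Qed.

Lemma dotp_ge0 x : 0 <= dotp x x.
Proof. by apply: sumr_ge0 => j _; rewrite -expr2 sqr_ge0. Qed.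

Lemma enorm_sqr x : enorm x ^+ 2 = dotp x x.
Proof. by rewrite sqr_sqrtr// dotp_ge0. Qed.

Lemma enorm_ge0 x : 0 <= enorm x.
Proof. exact: sqrtr_ge0. Qed.

Lemma enormZ c x : enorm (c *: x) = `|c| * enorm x.
Proof. by rewrite /enorm dotpZl dotpZr mulrA -expr2 sqrtrM ?sqr_ge0// sqrtr_sqr. Qed.

Lemma enormN x : enorm (- x) = enorm x.
Proof. by rewrite -scaleN1r enormZ normrN1 mul1r. Qed.

Lemma enorm_sqrD x y :
  enorm (x + y) ^+ 2 = enorm x ^+ 2 + 2 * dotp x y + enorm y ^+ 2.
Proof. by rewrite !enorm_sqr !dotpDl !dotpDr (dotpC y x); ring. Qed.

Lemma enorm_sqrB x y :
  enorm (x - y) ^+ 2 = enorm x ^+ 2 - 2 * dotp x y + enorm y ^+ 2.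
Proof. by rewrite enorm_sqrD enormN dotpNr; ring. Qed.

Lemma le_coord_enorm x j : `|x 0 j| <= enorm x.
Proof.
rewrite -sqrtr_sqr ler_wsqrtr// /dotp (bigD1 j)//= -expr2 lerDl.
by apply: sumr_ge0 => i _; rewrite -expr2 sqr_ge0.
Qed.

Lemma le_norm_enorm x : `|x| <= enorm x.
Proof.
rewrite -[`|x|]/(mx_norm x) mx_normrE.
apply/bigmax_leP; split => [|[i j] _ /=]; first exact: enorm_ge0.
by rewrite (ord1 i) le_coord_enorm.
Qed.

Lemma le_coord_norm x j : `|x 0 j| <= `|x|.
Proof.
rewrite -[`|x|]/(mx_norm x) mx_normrE.
exact: (le_bigmax_cond _ (fun ij => `|x ij.1 ij.2|) (j := (0, j))).
Qed.

(** The factor [n.+1] is cruder than the square root of [n], but it is positive even for [n = 0] and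
    can be divided by. *)
Lemma le_enorm_norm x : enorm x <= n.+1%:R * `|x|.
Proof.
have h0 : 0 <= n.+1%:R * `|x| by rewrite mulr_ge0.
rewrite -(ger0_norm h0) -sqrtr_sqr ler_wsqrtr//.
apply: (@le_trans _ _ (\sum_(j < n) `|x| ^+ 2)).
  apply: ler_sum => j _; rewrite -expr2 -real_normK ?num_real//.
  by rewrite ler_sqr ?nnegrE// le_coord_norm.
rewrite sumr_const card_ord -[leLHS]mulr_natl exprMn ler_wpM2r ?sqr_ge0//.
by rewrite -natrX ler_nat expnS expn1 (leq_trans (leqnSn n))// leq_pmulr.
Qed.

Lemma enorm0 : enorm (0 : 'rV[R]_n) = 0.
Proof. by rewrite /enorm dotp0 sqrtr0. Qed.

Lemma enorm_eq0 x : (enorm x == 0) = (x == 0).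
Proof.
apply/eqP/eqP => [x0|->]; last exact: enorm0.
by apply/normr0_eq0/eqP; rewrite eq_le normr_ge0 andbT -x0 le_norm_enorm.
Qed.

Lemma enorm_gt0 x : (0 < enorm x) = (x != 0).
Proof. by rewrite lt_def enorm_eq0 enorm_ge0 andbT. Qed.

Lemma dotp_le_enorm x y : dotp x y <= enorm x * enorm y.
Proof.
have [->|y0] := eqVneq y 0.
  by rewrite enorm0 mulr0 dotp0.
have ny : 0 < enorm y by rewrite enorm_gt0.
have [xy|xy] := leP (dotp x y) 0.
  by rewrite (le_trans xy)// mulr_ge0// enorm_ge0.
rewrite -ler_sqr ?nnegrE ?mulr_ge0 ?enorm_ge0 ?(ltW xy)//.
(* Cauchy-Schwarz: with [a], [b], [s] as named below, this square expands to
   [b ^+ 2 * (a ^+ 2 * b ^+ 2 - s ^+ 2)]. *)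
have := sqr_ge0 (enorm ((enorm y ^+ 2) *: x - dotp x y *: y)).
rewrite enorm_sqrB !enormZ dotpZl dotpZr !exprMn !real_normK ?num_real//.
set s := dotp x y; set a := enorm x; set b := enorm y => h.
have b2 : 0 < b ^+ 2 by rewrite exprn_gt0.
rewrite -subr_ge0 -(pmulr_rge0 _ b2); apply: le_trans h _.
by rewrite le_eqVlt; apply/orP; left; apply/eqP; ring.
Qed.

Lemma ler_enormD x y : enorm (x + y) <= enorm x + enorm y.
Proof.
rewrite -ler_sqr ?nnegrE ?addr_ge0 ?enorm_ge0// enorm_sqrD.
by have := dotp_le_enorm x y; nra.
Qed.

Lemma ler_enormB x y : enorm x - enorm y <= enorm (x - y).
Proof. by rewrite lerBlDr -{1}(subrK y x) ler_enormD. Qed.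

Lemma enorm_distC x y : enorm (x - y) = enorm (y - x).
Proof. by rewrite -enormN opprB. Qed.

(** The topology comes from the max norm; the two norm comparisons allow Euclidean balls instead. *)
Lemma nbhs_enormP x (A : set 'rV[R]_n) :
  nbhs x A <-> exists2 d, 0 < d & forall y, enorm (y - x) < d -> A y.
Proof.
split=> [/nbhs_ballP[d /= d0 dA]|[d d0 dA]].
  exists d => // y yx; apply: dA; rewrite -ball_normE/=.
  by rewrite distrC (le_lt_trans (le_norm_enorm _)).
apply/nbhs_ballP; exists (d / n.+1%:R) => [/=|y]; first by rewrite divr_gt0.
rewrite -ball_normE/= distrC ltr_pdivlMr ?ltr0n// mulrC => yx.
exact/dA/(le_lt_trans (le_enorm_norm _)).
Qed.

Lemma cvg_enormP (u : nat -> 'rV[R]_n) x :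
  u k @[k --> \oo] --> x <->
  forall e, 0 < e -> \forall k \near \oo, enorm (u k - x) < e.
Proof.
split=> [ux e e0|ux A /nbhs_enormP[d d0 dA]].
  by apply: (ux [set y | enorm (y - x) < e]); apply/nbhs_enormP; exists e.
by apply: filterS (ux d d0) => k; apply: dA.
Qed.

Lemma cvg_enorm_le (u : nat -> 'rV[R]_n) x (b : nat -> R) :
  (forall k, enorm (u k - x) <= b k) -> b k @[k --> \oo] --> 0 ->
  u k @[k --> \oo] --> x.
Proof.
move=> ub b0; apply/cvg_enormP => e e0.
have /cvgrPdist_lt/(_ e e0) := b0; apply: filterS => k.
by rewrite sub0r normrN => /(le_lt_trans (ler_norm _)); apply: le_lt_trans.
Qed.

Lemma closed_enorm (A : set 'rV[R]_n) x :
  closed A -> (forall e, 0 < e -> exists2 y, A y & enorm (y - x) < e) -> A x.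
Proof.
move=> Acl Ax; apply: Acl => B /nbhs_enormP[d /Ax[y Ay yx] dB].
by exists y; split => //; apply: dB.
Qed.

Lemma closed_enormP (A : set 'rV[R]_n) :
  (forall x, (forall e, 0 < e -> exists2 y, A y & enorm (y - x) < e) -> A x) ->
  closed A.
Proof.
move=> Acl x clx; apply: Acl => e e0.
have /clx[y []] : nbhs x [set y | enorm (y - x) < e].
  by apply/nbhs_enormP; exists e.
by exists y.
Qed.

(** Bolzano-Weierstrass by compactness of max-norm balls, stated with arbitrarily late indices so
    that no subsequence need be extracted. *)
Lemma bounded_seq_cluster (u : nat -> 'rV[R]_n) M :
  (forall k, enorm (u k) <= M) ->
  exists x, forall e N, 0 < e -> exists2 k, (N <= k)%N & enorm (u k - x) < e.
Proof.
move=> uM.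
pose A := [set x : 'rV[R]_n | `|x| <= M].
have Ac : compact A.
  apply: bounded_closed_compact.
    by exists M; split; [exact: num_real|move=> s Ms x /= /le_trans->//; exact: ltW].
  apply: (@preimage_closed _ _ (fun x : 'rV[R]_n => `|x|) [set t | t <= M]).
    by move=> x _; exact: norm_continuous.
  exact: closed_le.
have uA : (u k @[k --> \oo]) A.
  by exists 0%N => // k _; exact: le_trans (le_norm_enorm (u k)) (uM k).
have [x [_ xcl]] := Ac _ _ uA.
exists x => e N e0.
have [] := xcl (u @` [set k | (N <= k)%N]) [set y | enorm (y - x) < e].
- by exists N => // k /= Nk; exists k.
- by apply/nbhs_enormP; exists e.
by move=> _ [[k Nk <-] /= uk]; exists k.
Qed.

(** A constant depending on [x], valid on the unit ball around [x], suits functions of quadratic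
    growth such as the weighted squared distance. *)
Lemma enorm_lipschitz_continuous (f : 'rV[R]_n -> R) :
  (forall x, exists2 C, 0 <= C &
     forall y, enorm (y - x) <= 1 -> `|f x - f y| <= C * enorm (y - x)) ->
  continuous f.
Proof.
move=> fL x; have [C C0 fC] := fL x.
apply/(@cvgrPdist_lt _ _ _ (nbhs x) (nbhs_filter x)) => e e0.
have C1 : 0 < C + 1 by lra.
apply/nbhs_enormP; exists (Num.min 1 (e / (C + 1))).
  by rewrite lt_min ltr01 divr_gt0.
move=> y; rewrite lt_min => /andP[/ltW d1 de].
apply: le_lt_trans (fC _ d1) _.
move: de; rewrite ltr_pdivlMr//.
by have := enorm_ge0 (y - x); nra.
Qed.

Lemma enormB_continuous z : continuous (fun x => enorm (x - z)).
Proof.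
apply: enorm_lipschitz_continuous => x; exists 1; rewrite ?ler01// => y _.
rewrite mul1r ler_norml.
have := ler_enormB (x - z) (y - z); have := ler_enormB (y - z) (x - z).
have -> : y - z - (x - z) = y - x by apply/rowP => j; rewrite !mxE; ring.
have -> : x - z - (y - z) = x - y by apply/rowP => j; rewrite !mxE; ring.
by rewrite (enorm_distC x y) => h1 h2; apply/andP; split; lra.
Qed.

(** The part of [A] where [f] is at most [f x0] is compact, and its minimiser also beats the points
    outside it. *)
Lemma closed_coercive_argmin (A : set 'rV[R]_n) (f : 'rV[R]_n -> R) x0 r :
  closed A -> continuous f -> A x0 ->
  (forall x, A x -> f x <= f x0 -> enorm x <= r) ->
  exists2 x, A x & forall y, A y -> f x <= f y.
Proof.
move=> Acl fc Ax0 fr.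
pose B := A `&` [set x | f x <= f x0].
have Bcl : closed B.
  apply: closedI => //.
  by apply: (@preimage_closed _ _ f [set t | t <= f x0]) => [x _|]; [exact: fc|exact: closed_le].
have Bc : compact B.
  apply: bounded_closed_compact => //; exists r; split; first exact: num_real.
  move=> s rs x [Ax xf] /=; apply: le_trans (le_norm_enorm x) _.
  by apply/ltW/(le_lt_trans _ rs)/fr.
have [|c + cmin] := @EVT_min_rV _ _ f B _ Bc (continuous_subspaceT fc).
  by exists x0; split => //=.
rewrite inE => -[Ac cx0]; exists c => // y Ay.
have [yx0|yx0] := leP (f y) (f x0); first by apply: cmin; rewrite inE.
exact: le_trans cx0 (ltW yx0).
Qed.

End EuclideanSpace.

(** * Epsilon-normals, projections on cones, and contingent cones *)

Section Normals.
Context {R : realType} {n : nat}.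
Implicit Types (x y z v w : 'rV[R]_n) (A L Om : set 'rV[R]_n).

(** Unfolds the upper limit, an infimum of suprema, and clears the denominator; the case [y = x]
    then holds trivially, so the punctured neighbourhood disappears. *)
Lemma eps_normalsP eps x A z :
  eps_normals eps x A z <->
  forall e, eps < e -> exists2 d, 0 < d &
    forall y, A y -> enorm (y - x) < d -> dotp z (y - x) <= e * enorm (y - x).
Proof.
rewrite /eps_normals /limf_esup /=; split=> [h e eps_e|h].
  have /ereal_inf_lt[_ [V VF <-] Ve] : (ereal_inf
     [set ereal_sup [set (dotp z (y - x) / enorm (y - x))%:E | y in V]
       | V in within A x^'] < e%:E)%E by rewrite (le_lt_trans h)// lte_fin.
  have /nbhs_enormP[d d0 dV] : nbhs x [set y | y != x -> A y -> V y] by [].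
  exists d => // y Ay yx.
  have [->|yNx] := eqVneq y x.
    by rewrite subrr enorm0 mulr0 dotp0.
  have Vy : V y by exact: dV.
  rewrite -ler_pdivrMr ?enorm_gt0 ?subr_eq0// -lee_fin.
  by apply/ltW/(le_lt_trans _ Ve)/ereal_sup_ubound; exists y.
apply/lee_addgt0Pr => e e0.
have [|d d0 dA] := h (eps + e); first by rewrite ltrDl.
pose V := [set y | [/\ A y, y != x & enorm (y - x) < d]].
apply: (@le_trans _ _
    (ereal_sup [set (dotp z (y - x) / enorm (y - x))%:E | y in V])).
  apply: ereal_inf_lbound; exists V => //.
  suff : nbhs x [set y | y != x -> A y -> V y] by [].
  by apply/nbhs_enormP; exists d.
apply: ge_ereal_sup => _ [y [Ay yx yd] <-].
by rewrite -EFinD lee_fin ler_pdivrMr ?enorm_gt0 ?subr_eq0//; exact: dA.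
Qed.

Lemma proximal_eps_normals A x z C eps :
  0 < eps -> (forall y, A y -> dotp z (y - x) <= C * enorm (y - x) ^+ 2) ->
  eps_normals eps x A z.
Proof.
move=> eps0 zC; apply/eps_normalsP => e eps_e.
have C1 : 0 < `|C| + 1 by have := normr_ge0 C; lra.
exists (e / (`|C| + 1)) => [|y Ay]; first by rewrite divr_gt0// (lt_trans eps0).
rewrite ltr_pdivlMr// => yd; apply: le_trans (zC y Ay) _.
rewrite expr2 mulrA ler_wpM2r ?enorm_ge0//.
by have := enorm_ge0 (y - x); have := ler_norm C; nra.
Qed.

(** Expanding the minimality of [w] makes [y - w] a proximal normal at [w]. By homogeneity it
    remains one at [w / (k + 1)], and these points tend to 0. *)
Lemma projection_limiting_normal L y w c :
  (forall s v, 0 < s -> L v -> L (s *: v)) ->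
  L w -> (forall v, L v -> enorm (y - w) <= enorm (y - v)) -> 0 <= c ->
  limiting_normal_cone 0 L (c *: (y - w)).
Proof.
move=> Lcone Lw wmin c0; set z := y - w.
have zle v : L v -> 2 * dotp z (v - w) <= enorm (v - w) ^+ 2.
  move=> /wmin; rewrite -ler_sqr ?nnegrE ?enorm_ge0//.
  have -> : y - v = z - (v - w) by rewrite /z opprB addrA subrK.
  by rewrite -/z (enorm_sqrB z (v - w)); lra.
exists (fun k => k.+1%:R^-1), (fun k => k.+1%:R^-1 *: w), (fun=> c *: z).
split.
- by split; [move=> k; rewrite invr_gt0|exact: cvg_harmonic].
- by rewrite -[X in _ --> X](scale0r w); apply: cvgZr_tmp; exact: cvg_harmonic.
- by move=> k; apply: Lcone.
- exact: cvg_cst.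
(* Shrinking the base point by [k.+1] enlarges the proximal constant by the same factor, harmless
   since each [k] may have its own constant. *)
move=> k; apply: (@proximal_eps_normals _ _ _ (c * k.+1%:R)) => [|v Lv].
  by rewrite invr_gt0.
have k0 : 0 < k.+1%:R :> R by [].
have := zle (k.+1%:R *: v) (Lcone _ _ k0 Lv).
have -> : k.+1%:R *: v - w = k.+1%:R *: (v - k.+1%:R^-1 *: w).
  by rewrite scalerBr scalerA divff// scale1r.
rewrite dotpZr dotpZl enormZ exprMn real_normK ?num_real//.
set s := dotp z _; set q := enorm _ ^+ 2; set K : R := k.+1%:R => h.
have {}h : 2 * s <= K * q.
  by rewrite -(ler_pM2l k0) mulrCA (le_trans h)// expr2 -mulrA.
have q0 : 0 <= q by exact: sqr_ge0.
rewrite -mulrA ler_wpM2l//.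
have Kq : 0 <= K * q by rewrite mulr_ge0// ltW.
by lra.
Qed.

(** A single tolerance replaces the two sequences; conversely, they are chosen with tolerances
    [1 / (k + 1)]. *)
Lemma contingent_coneP x Om v :
  contingent_cone x Om v <->
  forall e, 0 < e -> exists t w,
    [/\ 0 < t, t < e, enorm (w - v) < e & Om (x + t *: w)].
Proof.
split=> [[t [w [t0 tc wc tw]]] e e0|h].
  have /cvgrPdist_lt/(_ e e0) tc' := tc.
  have /cvg_enormP/(_ e e0) wc' := wc.
  have [k [tk wk]] := filter_ex (filterI tc' wc').
  exists (t k), (w k); split=> //; apply: le_lt_trans tk.
  by rewrite sub0r normrN ler_norm.
have /choice[tw htw] : forall k, exists p : R * 'rV[R]_n,
    [/\ 0 < p.1, p.1 < k.+1%:R^-1, enorm (p.2 - v) < k.+1%:R^-1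
      & Om (x + p.1 *: p.2)].
  move=> k; have [|t [w tw]] := h k.+1%:R^-1; first by rewrite invr_gt0.
  by exists (t, w).
exists (fun k => (tw k).1), (fun k => (tw k).2); split.
- by move=> k; have [] := htw k.
- apply: (squeeze_cvgr _ (cvg_cst 0) cvg_harmonic).
  by near=> k; have [/ltW-> /ltW->] := htw k.
- by apply: (cvg_enorm_le _ cvg_harmonic) => k; have [_ _ /ltW] := htw k.
- by move=> k; have [] := htw k.
Unshelve. all: by end_near. Qed.

Lemma contingent_cone_closed x Om : closed (contingent_cone x Om).
Proof.
apply: closed_enormP => v h; apply/contingent_coneP => e e0.
have e20 : 0 < e / 2 by lra.
have [u /contingent_coneP/(_ _ e20)[t [w [t0 te wu Otw]]] uv] := h _ e20.
exists t, w; split=> //; first by lra.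
by rewrite -(subrK u w) -addrA (le_lt_trans (ler_enormD _ _))//; lra.
Qed.

Lemma contingent_coneZ x Om s v :
  0 < s -> contingent_cone x Om v -> contingent_cone x Om (s *: v).
Proof.
move=> s0 [t [w [t0 tc wc tw]]].
exists (fun k => s^-1 * t k), (fun k => s *: w k); split.
- by move=> k; rewrite mulr_gt0// invr_gt0.
- by rewrite -[X in _ --> X](mulr0 s^-1); apply: cvgMl_tmp.
- exact: cvgZl_tmp.
- by move=> k; rewrite scalerA mulrAC mulVf ?gt_eqF// mul1r.
Qed.

End Normals.

(** * From normals of the contingent cone to normals of the set *)

Section TangentialNormals.
Context {R : realType} {n : nat}.
Implicit Types (x y z v w : 'rV[R]_n) (Om : set 'rV[R]_n).

Lemma near_harmonic_lt (e : R) :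
  0 < e -> exists N, forall k, (N <= k)%N -> k.+1%:R^-1 < e.
Proof.
move=> e0; have /cvgrPdist_lt/(_ e e0)[N _ hN] := @cvg_harmonic R.
exists N => k /hN; rewrite /= sub0r normrN; apply: le_lt_trans.
exact: ler_norm.
Qed.

(* Minimising [3 eps |v - w| - <z, v - w>] over the rescaled sets
   [(Om - xb) / t] near [w] keeps the vector [z] itself: it is a [3 eps]-normal
   at each interior minimiser, and the minimisers converge to [w] as [t]
   decreases, because the limit set of the rescaled sets lies in the cone, where
   [w] is the only minimiser near [w]. *)
Lemma eps_normals_contingent Om xb w z eps e :
  closed Om -> 0 < eps -> 0 < e -> contingent_cone xb Om w ->
  eps_normals eps w (contingent_cone xb Om) z ->
  exists x, [/\ Om x, enorm (x - xb) < e & eps_normals (3 * eps) x Om z].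
Proof.
(* The slope [2 * eps] lies strictly between [eps], as [eps_normalsP] demands, and the penalty slope
   [3 * eps] of [f]. *)
move=> Omcl eps0 e0 Tw /eps_normalsP /(_ (2 * eps)) [|d d0 zd]; first by lra.
(* The closed ball of radius [r] around [w] lies inside the open ball where [zd] applies. *)
pose r := d / 2.
have r0 : 0 < r by rewrite /r; lra.
pose f v := 3 * eps * enorm (v - w) - dotp z (v - w).
pose C := 3 * eps + enorm z.
have C0 : 0 < C by have := enorm_ge0 z; rewrite /C; lra.
have fL x y : f x - f y <= C * enorm (y - x).
  have h1 := dotp_le_enorm z (y - x).
  have h2 := ler_enormB (x - w) (y - w).
  have eq1 : x - w - (y - w) = - (y - x) by apply/rowP => j; rewrite !mxE; ring.
  have eq2 : y - w = (y - x) + (x - w) by apply/rowP => j; rewrite !mxE; ring.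
  rewrite eq1 enormN in h2.
  have h3 : dotp z (y - w) = dotp z (y - x) + dotp z (x - w) by rewrite eq2 dotpDr.
  by rewrite /f /C h3; nra.
have fc : continuous f.
  apply: enorm_lipschitz_continuous => x; exists C => [|y _]; first exact: ltW.
  rewrite ler_norml fL andbT lerNl opprB.
  by apply: le_trans (fL y x) _; rewrite enorm_distC.
have fw : f w = 0 by rewrite /f subrr enorm0 dotp0; lra.
(* At each scale [p.1], [p.2] minimises [f] over the rescaled set in the ball. Its value is compared
   with that of a point [u] near [w], supplied by tangency of [w], where the Lipschitz bound and
   [f w = 0] apply. *)
have /choice[tv htv] : forall k, exists p : R * 'rV[R]_n,
    [/\ 0 < p.1 < k.+1%:R^-1, Om (xb + p.1 *: p.2), enorm (p.2 - w) <= r,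
      f p.2 <= C * k.+1%:R^-1
    & forall v, Om (xb + p.1 *: v) -> enorm (v - w) <= r -> f p.2 <= f v].
  move=> k.
  have m0 : 0 < Num.min r k.+1%:R^-1 by rewrite lt_min r0 invr_gt0/=.
  have /contingent_coneP/(_ _ m0)[t [u [t0 tk uw Ou]]] := Tw.
  move: tk uw; rewrite !lt_min => /andP[_ tk] /andP[/ltW ur /ltW uk].
  pose A := [set v | Om (xb + t *: v)] `&` [set v | enorm (v - w) <= r].
  have Acl : closed A.
    apply: closedI.
      apply: (@preimage_closed _ _ (fun v => xb + t *: v) Om) => // v _.
      apply: (@continuousD _ _ _ (cst xb) (fun u => t *: u)).
        exact: cst_continuous.
      exact: scaler_continuous.
    apply: (@preimage_closed _ _ (fun v => enorm (v - w)) [set s | s <= r]).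
      by move=> v _; exact: enormB_continuous.
    exact: closed_le.
  have Au : A u by [].
  have [v vA|v [Ov vr] vmin] := @closed_coercive_argmin _ _ A f u (r + enorm w) Acl fc Au.
    have [_ /= vr] := vA => _.
    by rewrite -(subrK w v) (le_trans (ler_enormD _ _))// lerD2r.
  exists (t, v); split => //=; first by rewrite t0.
    apply: le_trans (vmin _ Au) _; have := fL u w; rewrite fw subr0 enorm_distC.
    by move=> /le_trans; apply; rewrite ler_wpM2l// ltW.
  by move=> v' Ov' v'r; exact: vmin.
have vbound k : enorm (tv k).2 <= r + enorm w.
  have [_ _ h _ _] := htv k.
  by rewrite -(subrK w (tv k).2) (le_trans (ler_enormD _ _))// lerD2r.
have [v vcl] := bounded_seq_cluster vbound.
have Tv : contingent_cone xb Om v.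
  apply/contingent_coneP => s s0; have [N hN] := near_harmonic_lt s0.
  have [k Nk kv] := vcl s N s0; have [/andP[t0 tk] Ov _ _ _] := htv k.
  by exists (tv k).1, (tv k).2; split => //; exact: lt_trans tk (hN k Nk).
have vr : enorm (v - w) <= r.
  apply/ler_addgt0Pr => s s0; have [k _ kv] := vcl s 0%N s0.
  have [_ _ h _ _] := htv k.
  have -> : v - w = (v - (tv k).2) + ((tv k).2 - w) by rewrite subrKA.
  by rewrite (le_trans (ler_enormD _ _))// addrC lerD// enorm_distC ltW.
have fv : f v <= 0.
  apply/ler_addgt0Pr => s s0; rewrite add0r.
  have s1 : 0 < s / (2 * C) by rewrite divr_gt0// mulr_gt0.
  have [N hN] := near_harmonic_lt s1.
  have [k Nk kv] := vcl _ N s1; have [_ _ _ h _] := htv k.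
  have := fL v (tv k).2; have := hN k Nk; move: kv h.
  rewrite !ltr_pdivlMr ?mulr_gt0//; set q := k.+1%:R^-1 => kv h kN fvk.
  by nra.
(* Here [3 * eps * |v - w| <= <z, v - w> <= 2 * eps * |v - w|], which leaves only [v = w]. *)
have {Tv vr fv} vw : v = w.
  apply/eqP; rewrite -subr_eq0 -enorm_eq0 eq_le enorm_ge0 andbT.
  have /(zd _ Tv) : enorm (v - w) < d by rewrite /r in vr; lra.
  by move: fv; rewrite /f => h1 h2; nra.
have B0 : 0 < r + enorm w by have := enorm_ge0 w; lra.
have [N hN] := near_harmonic_lt (divr_gt0 e0 B0).
(* A minimiser within [r / 2] of [w] is interior: points within [r / 2] of it still compete in the
   ball of radius [r]. *)
have r20 : 0 < r / 2 by lra.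
have [k Nk kw] := vcl _ N r20.
have [/andP[t0 tk] Ov _ _ vmin] := htv k.
move: {htv hN vcl} (hN k Nk) (vbound k) t0 tk Ov vmin kw.
rewrite {}vw; move: (tv k) => [t u] /= hk ub t0 tk Ou umin uw.
exists (xb + t *: u); split => //.
  rewrite addrAC subrr add0r enormZ gtr0_norm//.
  by move: (lt_trans tk hk); rewrite ltr_pdivlMr//; have := enorm_ge0 u; nra.
apply/eps_normalsP => s hs; exists (t * (r / 2)) => [|y Oy].
  by rewrite mulr_gt0.
pose v' := t^-1 *: (y - xb).
have yE : y = xb + t *: v'.
  by rewrite /v' scalerA divff ?lt0r_neq0// scale1r addrCA subrr addr0.
have -> : y - (xb + t *: u) = t *: (v' - u).
  by rewrite yE opprD addrACA subrr add0r scalerBr.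
rewrite enormZ gtr0_norm// ltr_pM2l// dotpZr mulrCA ler_pM2l// => v'u.
have v'r : enorm (v' - w) <= r.
  have -> : v' - w = (v' - u) + (u - w) by rewrite subrKA.
  by rewrite (le_trans (ler_enormD _ _))//; lra.
rewrite yE in Oy; have := umin _ Oy v'r; rewrite /f => h.
have eq1 : v' - w = (v' - u) + (u - w) by rewrite subrKA.
(* Minimality bounds [<z, v' - u>] by [3 * eps * (|v' - w| - |u - w|)], and the triangle inequality
   bounds this by [3 * eps * |v' - u|]. *)
have := ler_enormD (v' - u) (u - w); rewrite -eq1.
have h3 : dotp z (v' - w) = dotp z (v' - u) + dotp z (u - w).
  by rewrite eq1 (dotpDr z (v' - u)).
rewrite h3 in h; have := enorm_ge0 (v' - u).
by nra.
Qed.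

Lemma limiting_normal_cone_contingent Om xb :
  closed Om ->
  limiting_normal_cone 0 (contingent_cone xb Om) `<=`
  limiting_normal_cone xb Om.
Proof.
move=> Omcl z [eps [w [zk [[eps0 epsc] _ Tw zkz zkN]]]].
have /choice[x hx] : forall k, exists x, [/\ Om x,
    enorm (x - xb) < k.+1%:R^-1 & eps_normals (3 * eps k) x Om (zk k)].
  by move=> k; apply: eps_normals_contingent (Tw k) (zkN k); rewrite ?invr_gt0.
exists (fun k => 3 * eps k), x, zk; split => //.
- split=> [k|]; first by rewrite mulr_gt0.
  by rewrite -[X in _ --> X](mulr0 3); apply: cvgMl_tmp.
- by apply: (cvg_enorm_le _ cvg_harmonic) => k; have [_ /ltW] := hx k.
- by move=> k; have [] := hx k.
- by move=> k; have [] := hx k.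
Qed.

End TangentialNormals.

(** * Series with dyadic weights *)

Section DyadicSums.
Context {R : realType}.
Implicit Types (f g : nat -> R) (M c : R).

(** A weighted mean, the weights having sum 1. The limit is meaningful only for a convergent series,
    which uniform bounds on [f] guarantee below. *)
Definition dyadic_sum f : R := limn (series (fun i => 1 / 2 ^+ i.+1 * f i)).

Lemma dyadic_weight_ge0 i : 0 <= 1 / 2 ^+ i.+1 :> R.
Proof. by rewrite divr_ge0// exprn_ge0. Qed.

Lemma dyadic_sum_cst c :
  series (fun i => 1 / 2 ^+ i.+1 * c) m @[m --> \oo] --> c.
Proof.
have -> : (fun i => 1 / 2 ^+ i.+1 * c) = (fun i => c / (2 ^ (i + 1))%:R).
  by apply/funext => i; rewrite addn1 natrX mul1r mulrC.
have := @cvg_geometric_series_half R c 0; by rewrite expr0 divr1.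
Qed.

Lemma dyadic_series_is_cvg f M :
  (forall i, `|f i| <= M) -> cvgn (series (fun i => 1 / 2 ^+ i.+1 * f i)).
Proof.
move=> fM; apply: normed_cvg.
apply: (@series_le_cvg _ _ (fun i => 1 / 2 ^+ i.+1 * M)) => [i|i|i|].
- exact: normr_ge0.
- by rewrite mulr_ge0 ?dyadic_weight_ge0// (le_trans _ (fM i)).
- by rewrite /= normrM (ger0_norm (dyadic_weight_ge0 i)) ler_wpM2l ?dyadic_weight_ge0.
- by apply/cvg_ex; exists M; exact: dyadic_sum_cst.
Qed.

Lemma dyadic_sum_cvg f M : (forall i, `|f i| <= M) ->
  (\sum_(0 <= i < m) 1 / 2 ^+ i.+1 * f i) @[m --> \oo] --> dyadic_sum f.
Proof. by move=> /dyadic_series_is_cvg. Qed.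

Lemma dyadic_sum_eq f c :
  (\sum_(0 <= i < m) 1 / 2 ^+ i.+1 * f i) @[m --> \oo] --> c ->
  dyadic_sum f = c.
Proof. by move=> fc; apply/cvg_lim. Qed.

Lemma dyadic_sumD f g M N :
  (forall i, `|f i| <= M) -> (forall i, `|g i| <= N) ->
  dyadic_sum (fun i => f i + g i) = dyadic_sum f + dyadic_sum g.
Proof.
move=> fM gN; apply: dyadic_sum_eq.
under eq_fun do under eq_bigr do rewrite mulrDr.
under eq_fun do rewrite big_split.
by apply: cvgD; [exact: dyadic_sum_cvg fM|exact: dyadic_sum_cvg gN].
Qed.

Lemma dyadic_sumZ c f M : (forall i, `|f i| <= M) ->
  dyadic_sum (fun i => c * f i) = c * dyadic_sum f.
Proof.
move=> fM; apply: dyadic_sum_eq.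
under eq_fun do under eq_bigr do rewrite mulrCA.
under eq_fun do rewrite -mulr_sumr.
by apply: cvgMl_tmp; exact: dyadic_sum_cvg fM.
Qed.

Lemma dyadic_sum_const c : dyadic_sum (fun=> c) = c.
Proof. exact/dyadic_sum_eq/dyadic_sum_cst. Qed.

Lemma ler_dyadic_sum f g M N :
  (forall i, `|f i| <= M) -> (forall i, `|g i| <= N) ->
  (forall i, f i <= g i) -> dyadic_sum f <= dyadic_sum g.
Proof.
move=> fM gN fg; apply: lim_series_le.
- exact: dyadic_series_is_cvg fM.
- exact: dyadic_series_is_cvg gN.
- by move=> i; rewrite ler_wpM2l ?dyadic_weight_ge0.
Qed.

(** Partial sums of nonnegative terms increase to the limit. This turns a bound on the total into a
    bound on each distance. *)
Lemma le_dyadic_sum f M i : (forall i, 0 <= f i <= M) ->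
  1 / 2 ^+ i.+1 * f i <= dyadic_sum f.
Proof.
move=> fM.
have term_ge0 j : 0 <= 1 / 2 ^+ j.+1 * f j.
  by rewrite mulr_ge0 ?dyadic_weight_ge0//; have /andP[] := fM j.
have cf : cvgn (series (fun i => 1 / 2 ^+ i.+1 * f i)).
  by apply: (@dyadic_series_is_cvg _ M) => j; have /andP[f0 ?] := fM j; rewrite ger0_norm.
apply: (@le_trans _ _ (series (fun i => 1 / 2 ^+ i.+1 * f i) i.+1)).
  by rewrite /series/= big_nat_recr//= lerDr sumr_ge0.
apply: nondecreasing_cvgn_le => //; apply/nondecreasing_seqP => k.
by rewrite /series/= big_nat_recr//= lerDl.
Qed.

End DyadicSums.

(** There are finitely many coordinates, so one tail of the sequence serves them all; the vector
    series thus reduces to real ones. *)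
Lemma cvg_rV_coord (R : realType) (n : nat) (u : nat -> 'rV[R]_n) (x : 'rV[R]_n) :
  (forall j, u k 0 j @[k --> \oo] --> x 0 j) -> u k @[k --> \oo] --> x.
Proof.
move=> ux; apply/cvg_enormP => e e0.
have e1 : 0 < e / n.+1%:R by rewrite divr_gt0.
have : \forall k \near \oo, forall j, `|x 0 j - u k 0 j| < e / n.+1%:R.
  apply: filter_forall => j.
  by have /cvgrPdist_lt/(_ _ e1) := ux j.
apply: filterS => k uk; apply: le_lt_trans (le_enorm_norm _) _.
rewrite mulrC -ltr_pdivlMr// -[`|_|]/(mx_norm _) mx_normrE.
apply/bigmax_ltP; split => // -[i j] _ /=.
by rewrite (ord1 i) !mxE distrC.
Qed.

(** * The variational argument for closed cones *)

Section ExtremalCones.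
Context {R : realType} {n : nat}.
Implicit Types x y v w h : 'rV[R]_n.

Lemma extremal_cones_normals (L : nat -> set 'rV[R]_n) (a : nat -> 'rV[R]_n) M :
  (forall i, closed (L i)) -> (forall i, L i 0) ->
  (forall i s v, 0 < s -> L i v -> L i (s *: v)) ->
  (forall x, (forall i, L i x) -> x = 0) ->
  (forall i, enorm (a i) <= M) ->
  (forall x, ~ forall i, L i (x + a i)) ->
  exists xs : nat -> 'rV[R]_n,
    [/\ forall i, limiting_normal_cone 0 (L i) (xs i),
        (\sum_(0 <= i < m) (1 / 2 ^+ i.+1) *: xs i) @[m --> \oo] --> (0 : 'rV[R]_n) &
        (\sum_(0 <= i < m) (1 / 2 ^+ i.+1) * enorm (xs i) ^+ 2)
          @[m --> \oo] --> (1 : R)].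
Proof.
move=> Lcl L0 Lcone Lcap aM Lext.
have M0 : 0 <= M := le_trans (enorm_ge0 _) (aM 0%N).
(* The cones need not be convex, so a projection is chosen for every pair of index and point. It
   exists because 0 competes, which confines candidates to norm at most [2 * enorm y]. *)
have /choice[p hp] : forall q : nat * 'rV[R]_n, exists w,
    L q.1 w /\ forall v, L q.1 v -> enorm (q.2 - w) <= enorm (q.2 - v).
  move=> [i y] /=.
  have [|w Lw wmin] := @closed_coercive_argmin _ _ (L i)
      (fun v => enorm (v - y)) 0 (2 * enorm y) (Lcl i) (@enormB_continuous _ _ y) (L0 i).
    move=> v _; rewrite sub0r enormN => vy.
    by rewrite -(subrK y v) (le_trans (ler_enormD _ _))//; lra.
  by exists w; split=> // v Lv; rewrite !(enorm_distC y); exact: wmin.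
pose d i x := enorm (x + a i - p (i, x + a i)).
have d_ge0 i x : 0 <= d i x by exact: enorm_ge0.
have d_min i x v : L i v -> d i x <= enorm (x + a i - v).
  by have [_ h] := hp (i, x + a i); exact: h.
have d_le i x : d i x <= enorm x + M.
  by rewrite (le_trans (d_min i x 0 (L0 i)))// subr0 (le_trans (ler_enormD _ _))// lerD2l.
have d_lip i x y : d i y <= d i x + enorm (y - x).
  have [Lp _] := hp (i, x + a i).
  rewrite (le_trans (d_min i y _ Lp))//=.
  have -> : y + a i - p (i, x + a i) = (x + a i - p (i, x + a i)) + (y - x).
    by apply/rowP => j; rewrite !mxE; ring.
  exact: ler_enormD.
have dd_le x i : `|d i x ^+ 2| <= (enorm x + M) ^+ 2.
  by rewrite ger0_norm ?sqr_ge0// ler_sqr ?nnegrE ?addr_ge0 ?enorm_ge0.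
pose D x := dyadic_sum (fun i => d i x ^+ 2).
have D_le x f B : (forall i, `|f i| <= B) -> (forall i, d i x ^+ 2 <= f i) ->
    D x <= dyadic_sum f.
  by move=> fB; exact: ler_dyadic_sum (dd_le x) fB.
have D_addc x c : D x + c = dyadic_sum (fun i => d i x ^+ 2 + c).
  by rewrite (dyadic_sumD (dd_le x) (fun=> lexx `|c|)) dyadic_sum_const.
have addc_le x c i : `|d i x ^+ 2 + c| <= (enorm x + M) ^+ 2 + `|c|.
  by rewrite (le_trans (ler_normD _ _))// lerD2r.
have D_cont : continuous D.
  (* In [(d i y + t) ^+ 2] the distance is at most [enorm x + M + t]; with [t <= 1] the excess over
     [d i y ^+ 2] is at most this constant times [t]. *)
  apply: enorm_lipschitz_continuous => x; exists (2 * (enorm x + M) + 3).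
    by have := enorm_ge0 x; lra.
  move=> y; have := enorm_ge0 (y - x); set t := enorm (y - x) => t0 t1.
  set c := _ * t.
  have dx0 := d_ge0 _ x; have dy0 := d_ge0 _ y; have dxM := d_le _ x.
  have Dyx : D y <= D x + c.
    rewrite D_addc; apply: (D_le _ _ _ (addc_le _ _)) => i.
    apply: (@le_trans _ _ ((d i x + t) ^+ 2)).
      by rewrite ler_sqr ?nnegrE ?addr_ge0.
    by have := dxM i; have := dx0 i; rewrite /c; nra.
  have Dxy : D x <= D y + c.
    rewrite D_addc; apply: (D_le _ _ _ (addc_le _ _)) => i.
    have yx := d_lip i x y.
    apply: (@le_trans _ _ ((d i y + t) ^+ 2)).
      by rewrite ler_sqr ?nnegrE ?addr_ge0// /t enorm_distC.
    by move: yx; rewrite -/t; have := dxM i; have := dx0 i; rewrite /c; nra.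
  by rewrite ler_distl lerBlDr Dyx.
have [r hr] : exists r, forall x, D x <= D 0 -> enorm x <= r.
  apply: contrapT => unbounded.
  have /choice[x hx] : forall k : nat, exists x, D x <= D 0 /\ k.+1%:R < enorm x.
    move=> k; apply: contrapT => kN; apply: unbounded; exists k.+1%:R => x xD.
    by rewrite leNgt; apply/negP => kx; apply: kN; exists x.
  have x0 k : 0 < enorm (x k) by have [_ /(lt_trans _)->] := hx k.
  pose u k := (enorm (x k))^-1 *: x k.
  have u1 k : enorm (u k) = 1.
    by rewrite enormZ ger0_norm ?invr_ge0 ?enorm_ge0// mulVf// gt_eqF.
  have u1le k : enorm (u k) <= 1 by rewrite u1.
  have [y ycl] := bounded_seq_cluster u1le.
  have y0 : y = 0.
    apply: Lcap => i; apply: closed_enorm => // e e0.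
    (* The term of index [i] is at most [D 0], so the squared distance is at most [Q]; bounding the
       distance by [Q + 1] avoids a root. *)
    pose Q := D 0 * 2 ^+ i.+1.
    have dQ k : d i (x k) <= Q + 1.
      have : d i (x k) ^+ 2 <= Q.
        have [/(le_trans _) xD _] := hx k.
        rewrite -ler_pdivrMr ?exprn_gt0// mulrC -[_^-1]mul1r; apply: xD.
        apply: (@le_dyadic_sum _ (fun i => d i (x k) ^+ 2)
                  ((enorm (x k) + M) ^+ 2)) => j.
        by rewrite sqr_ge0 (le_trans (ler_norm _)).
      by nra.
    have B0 : 0 < 2 * (Q + 2 + M) by have := dQ 0%N; have := d_ge0 i (x 0%N); lra.
    have [N hN] := near_harmonic_lt (divr_gt0 e0 B0).
    have [|k Nk uy] := ycl (e / 2) N; first lra.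
    have [Lp _] := hp (i, x k + a i); set q := p _ in Lp.
    (* The rescaled projection stays in the cone and is within [(Q + 2 + M) / enorm (x k)] of [u k],
       so [y] is a limit of points of [L i]. *)
    exists ((enorm (x k))^-1 *: q); first by apply: Lcone; rewrite ?invr_gt0.
    have -> : (enorm (x k))^-1 *: q - y = (enorm (x k))^-1 *: (q - x k) + (u k - y).
      by rewrite scalerBr subrKA.
    apply: le_lt_trans (ler_enormD _ _) _.
    rewrite enormZ ger0_norm ?invr_ge0 ?enorm_ge0//.
    have qx : enorm (q - x k) <= Q + 2 + M.
      have -> : q - x k = a i - (x k + a i - q) by apply/rowP => j; rewrite !mxE; ring.
      rewrite (le_trans (ler_enormD _ _))// enormN addrC lerD//.
      by apply: le_trans (dQ k) _; lra.
    have xk : (enorm (x k))^-1 < e / (2 * (Q + 2 + M)).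
      apply: lt_trans (hN k Nk).
      by have [_ ?] := hx k; rewrite ltf_pV2 ?posrE.
    move: xk; rewrite ltr_pdivlMr//.
    have : 0 < (enorm (x k))^-1 by rewrite invr_gt0.
    set s := (enorm (x k))^-1 => s0 hs.
    have : s * enorm (q - x k) <= s * (Q + 2 + M) by rewrite ler_wpM2l// ltW.
    by lra.
  have [|k _] := ycl (1 / 2) 0%N; first lra.
  by rewrite y0 subr0 u1; lra.
have [|x _ xmin] := @closed_coercive_argmin _ _ setT D 0 r closedT D_cont I.
  by move=> x _; exact: hr.
pose z i := x + a i - p (i, x + a i).
have zE i : enorm (z i) = d i x by [].
have Dx0 : 0 < D x.
  (* Otherwise all distances vanish and [x + a i] lies in every [L i]. *)
  rewrite ltNge; apply/negP => Dx; apply: (Lext x) => i.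
  have [Lp _] := hp (i, x + a i).
  suff /eqP -> : x + a i == p (i, x + a i) by [].
  rewrite -subr_eq0 -enorm_eq0 -sqrf_eq0 eq_le sqr_ge0 andbT.
  have : 1 / 2 ^+ i.+1 * d i x ^+ 2 <= 0.
    apply: le_trans Dx.
    apply: (@le_dyadic_sum _ (fun i => d i x ^+ 2) ((enorm x + M) ^+ 2)) => j.
    by rewrite sqr_ge0 (le_trans (ler_norm _)).
  by rewrite pmulr_rle0// divr_gt0// exprn_gt0.
have z_le j i : `|z i 0 j| <= enorm x + M.
  by rewrite (le_trans (le_coord_enorm _ _))// zE.
have zsum j : dyadic_sum (fun i => z i 0 j) = 0.
  (* With the projections frozen, the step [h] changes the quadratic majorant by
     [s ^+ 2 - 2 * s ^+ 2], so minimality of [D x] forces [s = 0]. *)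
  set s := dyadic_sum _; pose h := - s *: delta_mx 0 j : 'rV[R]_n.
  have hz i : dotp (z i) h = - s * z i 0 j by rewrite dotpZr dotpC dotp_delta.
  have hh : enorm h ^+ 2 = s ^+ 2.
    rewrite enormZ exprMn real_normK ?num_real// enorm_sqr dotp_delta mxE !eqxx.
    by rewrite mulr1 sqrrN.
  have lin_le i : `|- 2 * s * z i 0 j| <= `|- 2 * s| * (enorm x + M).
    by rewrite normrM ler_wpM2l.
  have sum_le i : `|(d i x ^+ 2 + s ^+ 2) + - 2 * s * z i 0 j|
      <= ((enorm x + M) ^+ 2 + `|s ^+ 2|) + `|- 2 * s| * (enorm x + M).
    by rewrite (le_trans (ler_normD _ _))// lerD.
  have : D (x + h) <= D x + s ^+ 2 + - 2 * s * s.
    rewrite D_addc -(dyadic_sumZ (- 2 * s) (z_le j)).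
    rewrite -(dyadic_sumD (addc_le _ _) lin_le).
    apply: (D_le _ _ _ sum_le) => i.
    have [Lp _] := hp (i, x + a i).
    have : d i (x + h) <= enorm (z i + h).
      have -> : z i + h = x + h + a i - p (i, x + a i).
        by rewrite /z (addrAC x h) (addrAC _ h).
      exact: d_min.
    rewrite -ler_sqr ?nnegrE ?enorm_ge0// => /le_trans; apply.
    by rewrite enorm_sqrD hz hh zE; lra.
  have := xmin (x + h) I.
  by move=> h1 h2; apply/eqP; rewrite -sqrf_eq0 eq_le sqr_ge0 andbT; nra.
pose c := (Num.sqrt (D x))^-1.
have c0 : 0 <= c by rewrite invr_ge0 sqrtr_ge0.
exists (fun i => c *: z i); split=> [i||].
- have [Lp pmin] := hp (i, x + a i).
  exact: projection_limiting_normal (@Lcone i) Lp pmin c0.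
- apply: cvg_rV_coord => j; rewrite mxE.
  have -> : (fun m => (\sum_(0 <= i < m) (1 / 2 ^+ i.+1) *: (c *: z i)) 0 j) =
      (fun m => c * \sum_(0 <= i < m) 1 / 2 ^+ i.+1 * z i 0 j).
    apply/funext => m; rewrite summxE mulr_sumr.
    by apply: eq_bigr => i _; rewrite !mxE; ring.
  have := dyadic_sum_cvg (z_le j); rewrite zsum => zc.
  by rewrite -[X in _ --> X](mulr0 c); apply: cvgMl_tmp.
have -> : (fun m => \sum_(0 <= i < m) (1 / 2 ^+ i.+1) * enorm (c *: z i) ^+ 2) =
    (fun m => (D x)^-1 * \sum_(0 <= i < m) 1 / 2 ^+ i.+1 * d i x ^+ 2).
  apply/funext => m; rewrite mulr_sumr; apply: eq_bigr => i _.
  rewrite enormZ exprMn real_normK ?num_real// /c exprVn sqr_sqrtr ?(ltW Dx0)// zE.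
  exact: mulrCA.
rewrite -[X in _ --> X](mulVf (lt0r_neq0 Dx0)).
by apply: cvgMl_tmp; exact: dyadic_sum_cvg (dd_le x).
Qed.

End ExtremalCones.

(* Om i stands for the set of index i + 1, whence the weights 1 / 2 ^ (i + 1). *)
Theorem theorem7p1 (R : realType) (n : nat) (Om : nat -> set 'rV[R]_n)
    (xb : 'rV[R]_n)
    (Om_closed : forall i, closed (Om i))
    (xb_in : (\bigcap_i Om i) xb)
    (xb_extremal : contingent_extremal xb Om)
    (nonoverlapping : \bigcap_i contingent_cone xb (Om i) = [set 0]) :
  exists xs : nat -> 'rV[R]_n,
    [/\ forall i, limiting_normal_cone 0 (contingent_cone xb (Om i)) (xs i),
        forall i, limiting_normal_cone 0 (contingent_cone xb (Om i))
                    `<=` limiting_normal_cone xb (Om i),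
        (\sum_(0 <= i < m) (1 / 2 ^+ i.+1) *: xs i) @[m --> \oo] --> (0 : 'rV[R]_n) &
        (\sum_(0 <= i < m) (1 / 2 ^+ i.+1) * enorm (xs i) ^+ 2)
          @[m --> \oo] --> (1 : R)].
Proof.
have [_ [a [[M aM] aext]]] := xb_extremal.
have T0 i : contingent_cone xb (Om i) 0.
  by have : [set 0] (0 : 'rV[R]_n) by []; rewrite -nonoverlapping => /(_ i I).
have [||||xs [xsN xs0 xs1]] := @extremal_cones_normals _ _
    (fun i => contingent_cone xb (Om i)) a M _ T0 _ _ aM.
- by move=> i; exact: contingent_cone_closed.
- by move=> i s v; exact: contingent_coneZ.
- move=> x Tx; have : (\bigcap_i contingent_cone xb (Om i)) x by move=> i _.
  by rewrite nonoverlapping.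
(* A vector [x] with [x + a i] in every cone is a common point of the translates, whose intersection
   is empty. *)
- move=> x Tx; have : (\bigcap_i [set x - a i | x in contingent_cone xb (Om i)]) x.
    by move=> i _; exists (x + a i); rewrite ?addrK.
  by rewrite aext.
exists xs; split=> // i; exact: limiting_normal_cone_contingent.
Qed.
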